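(* Let $\mathfrak{A}$ be a $C^*$-algebra, let $H$ be a Hilbert $\mathfrak{A}$-module, and let $\mathcal{L}(H)$ be the $C^*$-algebra of all adjointable operators on $H$. For every faithful representation $(\pi,X)$ of $\mathcal{L}(H)$ and every $T\in\mathcal{L}(H)$, we have $w\big(\pi(T)\big)\le w(T)$.
   Context: A (right) Hilbert $\mathfrak{A}$-module $H$ is a right $\mathfrak{A}$-module with an $\mathfrak{A}$-valued inner product $\langle\cdot,\cdot\rangle$ (linear in the second variable, conjugate-linear in the first) that is complete in the norm $\|x\|=\sqrt{\|\langle x,x\rangle\|}$. For $T\in\mathcal{L}(H)$, the numerical radius is $w(T)=\sup\{\|\langle Tx,x\rangle\| : x\in H,\ \|x\|=1\}$, where the norm of $\langle Tx,x\rangle$ is the norm of $\mathfrak{A}$. A representation of $\mathcal{L}(H)$ is a pair $(\pi,X)$ where $X$ is a (complex) Hilbert space and $\pi:\mathcal{L}(H)\to\mathbb{B}(X)$ is a $C^*$-morphism (a $*$-homomorphism) into the bounded operators on $X$; it is faithful if $\pi$ is injective. For $S\in\mathbb{B}(X)$, $w(S)=\sup\{|\langle Sx,x\rangle| : x\in X,\ \|x\|=1\}$ is the usual numerical radius. *)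

(* Defs.v *)
From HB Require Import structures.
From mathcomp Require Import all_boot all_order all_algebra.
From mathcomp Require Import all_classical all_reals all_analysis.
From mathcomp Require Import complex.

Set Implicit Arguments.
Unset Strict Implicit.
Unset Printing Implicit Defensive.

Import Order.TTheory GRing.Theory Num.Theory.
Import numFieldNormedType.Exports.

Local Open Scope classical_set_scope.
Local Open Scope ring_scope.
Local Open Scope complex_scope.

(* The multiplication is a new operation because MathComp rings have a unit, *)
(* whereas a C*-algebra need not have one. The field [cstarZ] uses the       *)
(* conjugation [Num.conj] of R[i]; norms of normed R[i]-modules are elements *)
(* of R[i] that are real and nonnegative.                                    *)
HB.mixin Record isCStarAlgebra (R : realType) A
    of CompleteNormedModule R[i] A := {
  cmul : A -> A -> A ;
  cstar : A -> A ;
  cmulA : associative cmul ;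
  cmulDl : left_distributive cmul +%R ;
  cmulDr : right_distributive cmul +%R ;
  cmulZl : forall (k : R[i]) (a b : A), cmul (k *: a) b = k *: cmul a b ;
  cmulZr : forall (k : R[i]) (a b : A), cmul a (k *: b) = k *: cmul a b ;
  cstarD : forall a b : A, cstar (a + b) = cstar a + cstar b ;
  cstarZ : forall (k : R[i]) (a : A), cstar (k *: a) = Num.conj k *: cstar a ;
  cstarM : forall a b : A, cstar (cmul a b) = cmul (cstar b) (cstar a) ;
  cstarK : involutive cstar ;
  cnormM : forall a b : A, `|cmul a b| <= `|a| * `|b| ;
  cnorm_star : forall a : A, `|cmul (cstar a) a| = `|a| ^+ 2
}.

#[short(type="cstarAlgType")]
HB.structure Definition CStarAlgebra (R : realType) :=
  {A of CompleteNormedModule R[i] A & isCStarAlgebra R A}.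

(* In a C*-algebra, the self-adjoint elements with nonnegative spectrum are   *)
(* exactly the elements of the form b^* b; this form needs no unit.          *)
Definition cpositive (R : realType) (A : cstarAlgType R) (a : A) : Prop :=
  exists b : A, a = cmul (cstar b) b.

(* Definiteness of the inner product follows from [mip_norm] and the         *)
(* definiteness of the norm.                                                 *)
HB.mixin Record isHilbertModule (R : realType) (A : cstarAlgType R) H
    of CompleteNormedModule R[i] H := {
  mact : H -> A -> H ;
  mactDl : forall (x y : H) (a : A), mact (x + y) a = mact x a + mact y a ;
  mactDr : forall (x : H) (a b : A), mact x (a + b) = mact x a + mact x b ;
  mactM : forall (x : H) (a b : A), mact x (cmul a b) = mact (mact x a) b ;
  mactZl : forall (k : R[i]) (x : H) (a : A), mact (k *: x) a = k *: mact x a ;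
  mactZr : forall (k : R[i]) (x : H) (a : A), mact x (k *: a) = k *: mact x a ;
  mip : H -> H -> A ;
  mipDr : forall x y z : H, mip x (y + z) = mip x y + mip x z ;
  mipZr : forall (k : R[i]) (x y : H), mip x (k *: y) = k *: mip x y ;
  mip_act : forall (x y : H) (a : A), mip x (mact y a) = cmul (mip x y) a ;
  mip_star : forall x y : H, cstar (mip x y) = mip y x ;
  mip_ge0 : forall x : H, cpositive (mip x x) ;
  mip_norm : forall x : H, `|x| = sqrtC `|mip x x|
}.

#[short(type="hilbertModType")]
HB.structure Definition HilbertModule (R : realType) (A : cstarAlgType R) :=
  {H of CompleteNormedModule R[i] H & isHilbertModule R A H}.

HB.mixin Record isHilbert (R : realType) X
    of CompleteNormedModule R[i] X := {
  dotp : X -> X -> R[i] ;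
  dotpDr : forall x y z : X, dotp x (y + z) = dotp x y + dotp x z ;
  dotpZr : forall (k : R[i]) (x y : X), dotp x (k *: y) = k * dotp x y ;
  dotp_conj : forall x y : X, Num.conj (dotp x y) = dotp y x ;
  dotp_ge0 : forall x : X, 0 <= dotp x x ;
  dotp_norm : forall x : X, `|x| = sqrtC (dotp x x)
}.

#[short(type="hilbertType")]
HB.structure Definition Hilbert (R : realType) :=
  {X of CompleteNormedModule R[i] X & isHilbert R X}.

Section AdjointableOperators.
Context {R : realType} {A : cstarAlgType R} (H : hilbertModType A).
Implicit Types (x y : H) (k : R[i]).

Definition is_mod_adjoint (T S : H -> H) : Prop :=
  forall x y, mip (T x) y = mip x (S y).

(* An adjointable map is automatically linear, A-linear and bounded. *)
Definition adjointable_pred : {pred H -> H} :=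
  fun T => `[< exists S : H -> H, is_mod_adjoint T S >].

Record adjointable := Adjointable {
  adjointable_fun :> H -> H ;
  adjointable_funP : adjointable_fun \in adjointable_pred }.

HB.instance Definition _ := [isSub for adjointable_fun].
HB.instance Definition _ := [Choice of adjointable by <:].

Lemma mip0r x : mip x 0 = 0 :> A.
Proof. by have := mipZr (0 : R[i]) x 0; rewrite !scale0r. Qed.

Lemma cstar0 : cstar 0 = 0 :> A.
Proof. by have := cstarZ (0 : R[i]) (0 : A); rewrite conjC0 !scale0r. Qed.

Lemma mip0l x : mip 0 x = 0 :> A.
Proof. by rewrite -mip_star mip0r cstar0. Qed.

Lemma mipDl x y z : mip (x + y) z = mip x z + mip y z :> A.
Proof. by rewrite -mip_star mipDr cstarD !mip_star. Qed.

Lemma mipZl k x y : mip (k *: x) y = Num.conj k *: mip x y :> A.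
Proof. by rewrite -mip_star mipZr cstarZ mip_star. Qed.

Lemma adjointable_submod_closed : submod_closed adjointable_pred.
Proof.
split=> [|k S T /asboolP[S' SS'] /asboolP[T' TT']].
  apply/asboolP; exists (fun=> 0) => x y.
  by rewrite mip0r /= mip0l.
apply/asboolP; exists (fun y => Num.conj k *: S' y + T' y) => x y.
by rewrite mipDr mipZr -SS' -TT' -mipZl -mipDl.
Qed.

HB.instance Definition _ :=
  GRing.isSubmodClosed.Build _ _ adjointable_pred adjointable_submod_closed.
HB.instance Definition _ := [SubChoice_isSubLmodule of adjointable by <:].

Lemma adjointable_comp_subproof (S T : adjointable) :
  (S \o T : H -> H) \in adjointable_pred.
Proof.
have /asboolP[S' SS'] := adjointable_funP S.
have /asboolP[T' TT'] := adjointable_funP T.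
by apply/asboolP; exists (T' \o S') => x y; rewrite /= SS' TT'.
Qed.

Definition adjointable_comp (S T : adjointable) : adjointable :=
  Adjointable (adjointable_comp_subproof S T).

Lemma adjointable_adjoint_ex (T : adjointable) :
  exists S : H -> H, is_mod_adjoint T S.
Proof. by have /asboolP := adjointable_funP T. Qed.

Definition adjoint_fun (T : adjointable) : H -> H :=
  projT1 (cid (adjointable_adjoint_ex T)).

Lemma adjoint_funP (T : adjointable) : is_mod_adjoint T (adjoint_fun T).
Proof. exact: projT2 (cid (adjointable_adjoint_ex T)). Qed.

Lemma adjoint_subproof (T : adjointable) : adjoint_fun T \in adjointable_pred.
Proof.
apply/asboolP; exists T => x y.
by rewrite -[LHS]mip_star -adjoint_funP mip_star.
Qed.

Definition adjoint (T : adjointable) : adjointable :=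
  Adjointable (adjoint_subproof T).

(* [Re] turns a norm, which is a real element of R[i], into an element of R. *)
(* The set is bounded because T is; it is empty when H = 0, and [sup] is     *)
(* then 0.                                                                   *)
Definition mod_numerical_radius (T : adjointable) : R :=
  sup [set complex.Re `|mip (T x) x : A| | x in [set x : H | `|x| = 1]].

End AdjointableOperators.

Section BoundedOperators.
Context {R : realType} (X : hilbertType R).

Definition bounded_op_pred : {pred X -> X} :=
  fun T => `[< linear T /\ exists M : R[i], forall x, `|T x| <= M * `|x| >].

Record bounded_op := BoundedOp {
  bounded_op_fun :> X -> X ;
  bounded_op_funP : bounded_op_fun \in bounded_op_pred }.

HB.instance Definition _ := [isSub for bounded_op_fun].
HB.instance Definition _ := [Choice of bounded_op by <:].

Lemma bounded_op_submod_closed : submod_closed bounded_op_pred.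
Proof.
split=> [|k S T /asboolP[linS [M leM]] /asboolP[linT [N leN]]].
  apply/asboolP; split=> [c x y|]; first by rewrite /= scaler0 addr0.
  by exists 0 => x; rewrite /= normr0 mul0r.
apply/asboolP; split=> [c x y|].
  change (k *: S (c *: x + y) + T (c *: x + y) =
          c *: (k *: S x + T x) + (k *: S y + T y)).
  rewrite linS linT !scalerDr !scalerA [k * c]mulrC.
  by rewrite addrACA.
exists (`|k| * M + N) => x.
rewrite mulrDl (le_trans (ler_normD _ _))// lerD//.
by rewrite normrZ -mulrA ler_wpM2l.
Qed.

HB.instance Definition _ :=
  GRing.isSubmodClosed.Build _ _ bounded_op_pred bounded_op_submod_closed.
HB.instance Definition _ := [SubChoice_isSubLmodule of bounded_op by <:].

Lemma bounded_op_comp_subproof (S T : bounded_op) :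
  (S \o T : X -> X) \in bounded_op_pred.
Proof.
have /asboolP[linS [M leM]] := bounded_op_funP S.
have /asboolP[linT [N leN]] := bounded_op_funP T.
apply/asboolP; split=> [c x y|]; first by rewrite /= linT linS.
exists (`|M| * N) => x; rewrite -mulrA /=.
have M_le y : `|S y| <= `|M| * `|y|.
  have ge0 : 0 <= M * `|y| := le_trans (normr_ge0 _) (leM y).
  by rewrite (le_trans (leM y))// -[leLHS](ger0_norm ge0) normrM normr_id.
by rewrite (le_trans (M_le _))// ler_wpM2l.
Qed.

Definition bounded_op_comp (S T : bounded_op) : bounded_op :=
  BoundedOp (bounded_op_comp_subproof S T).

Definition is_op_adjoint (T S : bounded_op) : Prop :=
  forall x y : X, dotp (T x) y = dotp x (S y).

Definition op_numerical_radius (S : bounded_op) : R :=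
  sup [set complex.Re `|dotp (S x) x| | x in [set x : X | `|x| = 1]].

End BoundedOperators.

(* A *-homomorphism need not preserve the identity operator. Compatibility   *)
(* with the involution is stated through the relation [is_op_adjoint], which *)
(* determines the adjoint of a bounded operator uniquely.                    *)
Record representation (R : realType) (A : cstarAlgType R)
    (H : hilbertModType A) (X : hilbertType R) := Representation {
  repr_map :> {linear adjointable H -> bounded_op X} ;
  repr_comp : forall S T : adjointable H,
    repr_map (adjointable_comp S T) = bounded_op_comp (repr_map S) (repr_map T) ;
  repr_adjoint : forall T : adjointable H,
    is_op_adjoint (repr_map T) (repr_map (adjoint T))
}.

Definition faithful (R : realType) (A : cstarAlgType R)
    (H : hilbertModType A) (X : hilbertType R) (pi : representation H X) : Prop :=
  injective pi.

(* Main.v *)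
Require Import Defs.
From HB Require Import structures.
From mathcomp Require Import all_boot all_order all_algebra.
From mathcomp Require Import all_classical all_reals all_analysis.
From mathcomp Require Import complex.
From mathcomp Require Import ring lra.
Import Order.TTheory GRing.Theory Num.Theory.
Import numFieldNormedType.Exports.
Local Open Scope classical_set_scope.
Local Open Scope ring_scope.

Set Implicit Arguments.
Unset Strict Implicit.
Unset Printing Implicit Defensive.

(** Let [c >= 0] bound the numerical radius of a self-adjoint [S] in L(H), and
    let [lam > c]. The operator [lam - S] is invertible in L(H): with
    [N = lam + M], it equals [N - (M + S)], and expanding the inner product,
    [<(M + S) x, (M + S) x> = M^2 <x, x> + 2 M <S x, x> + <S x, S x>]
    has norm at most [(M^2 + 2 M c + s^2) |x|^2], where [s] bounds [S]. For
    large [M] this constant is below [N^2], because [2 M c] loses against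
    [2 M lam], so that [N^-1 (M + S)] is a strict contraction and a fixed point
    argument solves [(lam - S) x = y]; the solution operator is adjointable
    ([resolvent_exists]).

    A *-homomorphism [pi] carries the inverse of [lam - S] to a bounded left
    inverse of [lam - pi S], up to the projection [pi 1], which may differ from
    the identity ([representation_resolvent]). On a Hilbert space, the supremum
    of the quadratic form of a symmetric operator [B] on the unit sphere is an
    approximate eigenvalue of [B]; hence it cannot exceed [c] when [lam - B] is
    bounded below for every [lam > c] ([symmetric_le_of_resolvents]). So
    [<pi S x, x> <= c] for every unit [x].

    For an arbitrary [T] and a unit vector [x] of X, put [z = <pi T x, x>] and
    apply this to half the sum [S] of [z T] and its adjoint: the numerical
    radius of [S] is at most [|z| w(T)], and [<pi S x, x> = |z|^2], whence
    [|z| <= w(T)].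

    Two preliminary facts about H come from completeness and polarization
    alone: the inner product satisfies [|<x, y>| <= 4 |x| |y|]
    ([rnorm_mip_le]), and adjointable maps are bounded
    ([adjointable_bounded]). Without the latter the supremum defining [w(T)]
    would say nothing about [T]. *)

Local Notation "x %:C" := (real_complex _ x) : ring_scope.

(** * Real-valued norms over the complex scalars *)

Section RealNorm.
Context {R : realType}.

(** Norms of modules over R[i] are elements of R[i]. Their real parts live in
    R, which is totally ordered, so that inequalities between them can be
    negated and compared with suprema. *)
Definition rnorm {V : normedZmodType R[i]} (x : V) : R := complex.Re `|x|.

Section Zmod.
Context {V : normedZmodType R[i]}.
Implicit Types x y : V.

Lemma rnormE x : (rnorm x)%:C = `|x|.
Proof. by rewrite /rnorm RRe_real// normr_real. Qed.

Lemma rnorm_ge0 x : 0 <= rnorm x.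
Proof. by rewrite -lecR rnormE normr_ge0. Qed.

Lemma rnorm0 : rnorm (0 : V) = 0.
Proof. by rewrite /rnorm normr0. Qed.

Lemma rnorm_eq0 x : (rnorm x == 0) = (x == 0).
Proof. by rewrite -(normr_eq0 x) -rnormE eq_complex /= eqxx andbT. Qed.

Lemma rnorm_gt0 x : (0 < rnorm x) = (x != 0).
Proof. by rewrite lt_neqAle rnorm_ge0 andbT eq_sym rnorm_eq0. Qed.

Lemma rnormD x y : rnorm (x + y) <= rnorm x + rnorm y.
Proof. by rewrite -lecR rmorphD /= !rnormE ler_normD. Qed.

Lemma rnormN x : rnorm (- x) = rnorm x.
Proof. by rewrite /rnorm normrN. Qed.

Lemma rnormB x y : rnorm (x - y) <= rnorm x + rnorm y.
Proof. by rewrite -(rnormN y) rnormD. Qed.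

Lemma rdistC x y : rnorm (x - y) = rnorm (y - x).
Proof. by rewrite -rnormN opprB. Qed.

Lemma rdist_triangle y x z : rnorm (x - z) <= rnorm (x - y) + rnorm (y - z).
Proof. by rewrite -[x - z](subrKA y) rnormD. Qed.
End Zmod.

Lemma rnorm_real (r : R) : rnorm r%:C = `|r|.
Proof. by rewrite /rnorm normc_def /= expr0n addr0 sqrtr_sqr. Qed.

Lemma rnorm_conj (z : R[i]) : rnorm (Num.conj z) = rnorm z.
Proof. by rewrite /rnorm norm_conjC. Qed.

Section Normed.
Context {V : normedModType R[i]}.
Implicit Types x y : V.

Lemma rnormZ (k : R[i]) x : rnorm (k *: x) = rnorm k * rnorm x.
Proof.
apply: (@complexI R); rewrite rmorphM /=.
by rewrite (rnormE k) !(rnormE x, rnormE (k *: x)) normrZ.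
Qed.

Lemma rnormZr (r : R) x : rnorm (r%:C *: x) = `|r| * rnorm x.
Proof. by rewrite rnormZ rnorm_real. Qed.
End Normed.

Section Complete.
Context {V : completeNormedModType R[i]}.

Lemma geometric_steps_dist (u : nat -> V) (C q : R) (q0 : 0 <= q) (q1 : q < 1)
    (step : forall n, rnorm (u n.+1 - u n) <= C * q ^+ n) n k :
  rnorm (u (n + k)%N - u n) <= C * q ^+ n / (1 - q).
Proof.
have C0 : 0 <= C by have := step 0%N; rewrite expr0 mulr1; apply/le_trans/rnorm_ge0.
have q1' : 0 < 1 - q by rewrite subr_gt0.
suff : rnorm (u (n + k)%N - u n) <= C * q ^+ n * (1 - q ^+ k) / (1 - q).
  move=> /le_trans; apply.
  rewrite ler_pM2r ?invr_gt0// ler_piMr ?mulr_ge0 ?exprn_ge0//.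
  by rewrite gerBl exprn_ge0.
elim: k => [|k IHk]; first by rewrite addn0 subrr rnorm0 expr0 subrr mulr0 mul0r.
rewrite addnS; apply: (le_trans (rdist_triangle (u (n + k)%N) _ _)).
apply: (le_trans (lerD (step _) IHk)).
rewrite le_eqVlt; apply/orP; left; apply/eqP.
rewrite exprD exprS; field.
by rewrite gt_eqF.
Qed.

(** The explicit rate matters, and not only convergence: in
    [adjointable_bounded] the tail of the sequence has to be small compared with
    its last step. *)
Lemma geometric_steps_cvg (u : nat -> V) (C q : R) (q0 : 0 <= q) (q1 : q < 1)
    (step : forall n, rnorm (u n.+1 - u n) <= C * q ^+ n) :
  exists l : V, forall n, rnorm (l - u n) <= C * q ^+ n / (1 - q).
Proof.
have dist := geometric_steps_dist q0 q1 step.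
have small (e : R) : 0 < e -> exists n, C * q ^+ n / (1 - q) < e.
  move=> e0.
  have /cvgrPdist_lt/(_ e e0)[N _ /(_ N (leqnn N))] :
      geometric (C / (1 - q)) q @ \oo --> (0 : R).
    by apply: cvg_geometric; rewrite ger0_norm.
  by rewrite sub0r normrN /= mulrAC => /(le_lt_trans (ler_norm _)) ?; exists N.
have cu : cvg (u @ \oo).
  apply: cauchy_cvg; apply: cauchy_exP => e e0.
  have er : e = (complex.Re e)%:C by rewrite RRe_real// gtr0_real.
  have er0 : 0 < complex.Re e by rewrite -ltcR -er.
  have [n nlt] := small _ er0.
  exists (u n); exists n => //= m /= /subnKC <-.
  rewrite -ball_normE /ball_ /= distrC er -rnormE ltcR.
  exact: le_lt_trans (dist _ _) nlt.
exists (lim (u @ \oo)) => n; apply/ler_addgt0Pr => e e0.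
have /cvgrPdist_lt/(_ e%:C) := cu; rewrite ltcR => /(_ e0)[N _ /= near].
have := near (maxn N n) (leq_maxl _ _); rewrite -rnormE ltcR => lt_e.
apply: (le_trans (rdist_triangle (u (maxn N n)) _ _)).
by rewrite addrC lerD// ?(ltW lt_e)// -(subnKC (leq_maxr N n)).
Qed.

(** The Banach fixed point theorem, for complex scalars. *)
Lemma contraction_fixpoint (f : V -> V) (q : R) (q0 : 0 <= q) (q1 : q < 1)
    (fq : forall x y, rnorm (f x - f y) <= q * rnorm (x - y)) :
  exists x, f x = x.
Proof.
pose u n := iter n f 0; pose C := rnorm (u 1%N - u 0%N).
have step n : rnorm (u n.+1 - u n) <= C * q ^+ n.
  elim: n => [|n IHn]; first by rewrite expr0 mulr1.
  by rewrite (le_trans (fq _ _))// exprS mulrCA ler_wpM2l.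
have [l lP] := geometric_steps_cvg q0 q1 step.
exists l; apply/eqP; rewrite -subr_eq0 -rnorm_eq0 eq_le rnorm_ge0 andbT.
have bound n : rnorm (f l - l) <= (2 * C / (1 - q)) * q ^+ n.
  apply: (le_trans (rdist_triangle (u n.+1) _ _)).
  rewrite (rdistC (u n.+1)).
  have h1 : rnorm (f l - u n.+1) <= C * q ^+ n / (1 - q).
    apply: (le_trans (fq _ _)); apply: le_trans (lP n).
    by rewrite ler_piMl ?rnorm_ge0// ltW.
  have h2 : rnorm (l - u n.+1) <= C * q ^+ n / (1 - q).
    apply: (le_trans (lP _)).
    rewrite ler_pM2r ?invr_gt0 ?subr_gt0//.
    by rewrite ler_wpM2l ?rnorm_ge0// exprS ler_piMl ?exprn_ge0// ltW.
  apply: (le_trans (lerD h1 h2)); rewrite le_eqVlt; apply/orP; left; apply/eqP.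
  by ring.
apply/ler_addgt0Pr => e e0; rewrite add0r.
have /cvgrPdist_lt/(_ e e0)[N _ /(_ N (leqnn N))] :
    geometric (2 * C / (1 - q)) q @ \oo --> (0 : R).
  by apply: cvg_geometric; rewrite ger0_norm.
rewrite sub0r normrN /= => /(le_lt_trans (ler_norm _))/ltW.
exact: le_trans (bound N).
Qed.
End Complete.
End RealNorm.

(** * The inner product of a Hilbert module *)

Lemma conj_real_complex (R : realType) (r : R) : Num.conj (r%:C) = r%:C :> R[i].
Proof. by apply: conj_Creal; rewrite complex_real. Qed.

Section HilbertModules.
Context {R : realType} {A : cstarAlgType R} (H : hilbertModType A).
Implicit Types (x y : H) (S T : adjointable H).

Lemma rnorm_cstar (a : A) : rnorm (cstar a) = rnorm a.
Proof.
suff le_star (b : A) : rnorm b <= rnorm (cstar b).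
  apply/eqP; rewrite eq_le le_star andbT.
  by have := le_star (cstar a); rewrite cstarK.
have [->|b0] := eqVneq b 0; first by rewrite rnorm0 rnorm_ge0.
rewrite -(ler_pM2r (_ : 0 < rnorm b)) ?rnorm_gt0//.
rewrite -lecR !rmorphM /= (rnormE b) (rnormE (cstar b)) -expr2 -cnorm_star.
exact: cnormM.
Qed.

Lemma rnorm_mip x : rnorm (mip x x : A) = rnorm x ^+ 2.
Proof.
apply: (@complexI R); rewrite rmorphXn /= (rnormE x) (rnormE (mip x x)).
by rewrite mip_norm sqrtCK.
Qed.

Lemma mipNr x y : mip x (- y) = - mip x y :> A.
Proof. by rewrite -scaleN1r mipZr scaleN1r. Qed.

Lemma mipNl x y : mip (- x) y = - mip x y :> A.
Proof. by rewrite -scaleN1r mipZl rmorphN1 scaleN1r. Qed.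

Lemma mipBr x y z : mip x (y - z) = mip x y - mip x z :> A.
Proof. by rewrite mipDr mipNr. Qed.

Lemma mipBl x y z : mip (x - y) z = mip x z - mip y z :> A.
Proof. by rewrite mipDl mipNl. Qed.

Lemma mip_inj x y : (forall z, mip x z = mip y z :> A) -> x = y.
Proof.
move=> eq_xy; apply/eqP; rewrite -subr_eq0 -rnorm_eq0 -sqrf_eq0.
by rewrite -rnorm_mip mipBl eq_xy subrr rnorm0.
Qed.

Lemma mip_parallelogramB x y :
  mip (x + y) (x + y) - mip (x - y) (x - y) = 2 *: (mip x y + mip y x) :> A.
Proof.
have -> : mip (x + y) (x + y) =
    (mip x x + mip y y) + (mip x y + mip y x) :> A.
  by rewrite mipDr !mipDl [mip x y + _]addrC addrACA [mip y x + _]addrC.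
have -> : mip (x - y) (x - y) =
    (mip x x + mip y y) - (mip x y + mip y x) :> A.
  by rewrite mipBr !mipBl opprB opprD addrACA [- mip y x + _]addrC.
by rewrite opprB addrC subrKA scaler_nat mulr2n.
Qed.

Lemma mip_polarization x y :
  4 *: mip x y = (mip (x + y) (x + y) - mip (x - y) (x - y))
    - 'i *: (mip (x + 'i *: y) (x + 'i *: y) - mip (x - 'i *: y) (x - 'i *: y)) :> A.
Proof.
rewrite !mip_parallelogramB mipZl mipZr conjCi scaleNr -scalerBr.
rewrite !scalerA mulrAC -expr2 sqrCi mulN1r scaleNr opprK.
rewrite -scalerDr addrACA subrr addr0 -mulr2n.
by rewrite -(scaler_nat 2 (mip x y)) scalerA -natrM.
Qed.

(** A Cauchy-Schwarz inequality up to the factor 4. Only the triangle inequality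
    is used, through polarization: on the unit ball each of the four squares has
    norm at most [(1 + 1)^2]. *)
Lemma rnorm_mip_le x y : rnorm (mip x y : A) <= 4 * rnorm x * rnorm y.
Proof.
have rnormi : rnorm ('i : R[i]) = 1 by rewrite /rnorm normCi.
have mip_unit (u v : H) : rnorm u <= 1 -> rnorm v <= 1 ->
    rnorm (mip u v : A) <= 4.
  move=> u1 v1.
  have sq (w w' : H) : rnorm w <= 1 -> rnorm w' <= 1 ->
      rnorm (mip (w + w') (w + w') : A) <= 4.
    move=> w1 w1'; rewrite rnorm_mip.
    have := rnormD w w'; have := rnorm_ge0 (w + w'); nra.
  have iv1 : rnorm ('i *: v) <= 1 by rewrite rnormZ rnormi mul1r.
  have sqN (w w' : H) : rnorm w <= 1 -> rnorm w' <= 1 ->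
      rnorm (mip (w - w') (w - w') : A) <= 4.
    by move=> w1 w1'; apply: sq; rewrite ?rnormN.
  have : rnorm (4 *: mip u v : A) <= 4 + 4 + 4 + 4.
    rewrite mip_polarization.
    have h1 := sq _ _ u1 v1; have h2 := sqN _ _ u1 v1.
    have h3 := sq _ _ u1 iv1; have h4 := sqN _ _ u1 iv1.
    apply: (le_trans (rnormB _ _)); rewrite rnormZ rnormi mul1r -addrA.
    by apply: lerD; apply: (le_trans (rnormB _ _)); exact: lerD.
  rewrite -(rmorph_nat (real_complex R) 4) rnormZr ger0_norm// => ?.
  by lra.
have [->|x0] := eqVneq x 0; first by rewrite mip0l rnorm0 !mulr_ge0 ?rnorm_ge0.
have [->|y0] := eqVneq y 0; first by rewrite mip0r rnorm0 !mulr_ge0 ?rnorm_ge0.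
move: x0 y0; rewrite -!rnorm_gt0 => x0 y0.
have unit (w : H) : 0 < rnorm w -> rnorm ((rnorm w)^-1%:C *: w) <= 1.
  by move=> w0; rewrite rnormZr ger0_norm ?invr_ge0 ?rnorm_ge0// mulVf ?gt_eqF.
have := mip_unit _ _ (unit x x0) (unit y y0).
rewrite mipZl mipZr conj_real_complex !rnormZr !ger0_norm ?invr_ge0 ?rnorm_ge0//.
rewrite mulrA -invfM mulrC ler_pdivrMr ?mulr_gt0//.
by rewrite mulrA.
Qed.

(** * Adjointable operators *)

Lemma mip_adjoint T x y : mip (T x) y = mip x (adjoint T y) :> A.
Proof. exact: adjoint_funP. Qed.

(** Uniform boundedness of the functionals [x |-> <T y, x>], [|y| <= 1], which
    are pointwise bounded because [<T y, x> = <y, T^* x>]. The proof is a gliding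
    hump: if [T y_n] is large compared with [y_n], a limit [l] is built in steps
    [+- v_n] of length [9^-n] in the direction [T y_n], with the sign that makes
    [<T y_n, .>] large; then [<y_n, T^* l>] outgrows [|y_n|]. *)
Lemma adjointable_bounded T :
  exists2 C : R, 0 <= C & forall x, rnorm (T x) <= C * rnorm x.
Proof.
apply: contrapT => unbounded.
(* The ratio 1/9 makes the tail after step [n] at most 1/8 of that step, which
   the factor 4 of [rnorm_mip_le] turns into one half; 18 = 2 * 9 then leaves a
   growth of order 2^n. *)
have large n : exists y, 18 ^+ n * rnorm y < rnorm (T y).
  apply: contrapT => small; apply: unbounded; exists (18 ^+ n).
    by rewrite exprn_ge0.
  by move=> x; rewrite leNgt; apply/negP => ?; apply: small; exists x.
have [y yP] := choice large.
have Ty0 n : 0 < rnorm (T (y n)).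
  by apply: le_lt_trans (yP n); rewrite mulr_ge0 ?exprn_ge0 ?rnorm_ge0.
pose v n : H := (9^-1 ^+ n / rnorm (T (y n)))%:C *: T (y n).
have v_norm n : rnorm (v n) = 9^-1 ^+ n.
  rewrite rnormZr ger0_norm ?divfK ?gt_eqF//.
  by rewrite divr_ge0 ?rnorm_ge0 ?exprn_ge0 ?invr_ge0.
have mip_v n : rnorm (mip (T (y n)) (v n) : A) = 9^-1 ^+ n * rnorm (T (y n)).
  rewrite mipZr rnormZr rnorm_mip ger0_norm; last first.
    by rewrite divr_ge0 ?rnorm_ge0 ?exprn_ge0 ?invr_ge0.
  by rewrite expr2 mulrA divfK ?gt_eqF.
pose f n x : R := rnorm (mip (T (y n)) x : A).
pose step n x := if f n (x + v n) < f n (x - v n) then x - v n else x + v n.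
(* One of [x + v_n], [x - v_n] does as well as [v_n], since their difference is
   twice [v_n]. *)
have step_large n x : f n (v n) <= f n (step n x).
  have : 2 * f n (v n) <= f n (x + v n) + f n (x - v n).
    have -> : 2 * f n (v n) = f n ((x + v n) - (x - v n)).
      rewrite opprB addrC subrKA -mulr2n -(scaler_nat 2 (v n)) /f.
      rewrite -(rmorph_nat (real_complex R) 2) (mipZr _ _ (v n)).
      by rewrite rnormZr ger0_norm.
    by rewrite /f mipBr rnormB.
  by rewrite /step; case: ltP => ? ?; lra.
pose u := fix u n := if n is m.+1 then step m (u m) else 0.
have u_step n : rnorm (u n.+1 - u n) <= 1 * 9^-1 ^+ n.
  rewrite mul1r -v_norm /= /step.
  by case: ifP; rewrite addrAC subrr add0r ?rnormN.
have [||l lP] := geometric_steps_cvg (_ : 0 <= 9^-1) (_ : 9^-1 < 1) u_step.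
- by rewrite invr_ge0.
- by rewrite invf_lt1// ltr1n.
have low n : 9^-1 ^+ n * rnorm (T (y n)) <= 2 * f n l.
  have d : f n (l - u n.+1) <= 2^-1 * (9^-1 ^+ n * rnorm (T (y n))).
    apply: (le_trans (rnorm_mip_le _ _)).
    have := lP n.+1; have := Ty0 n; have := rnorm_ge0 (l - u n.+1).
    rewrite exprS; set e := 9^-1 ^+ n.
    have e0 : 0 <= e by rewrite exprn_ge0 ?invr_ge0.
    have -> : 1 * (9^-1 * e) / (1 - 9^-1) = 8^-1 * e :> R by field.
    nra.
  have := step_large n (u n); rewrite {1}/f mip_v -/(u n.+1).
  have : f n (u n.+1) <= f n l + f n (l - u n.+1).
    rewrite /f mipBr; apply: le_trans (rnormB _ _).
    by rewrite subKr.
  lra.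
have up n : f n l <= 4 * rnorm (y n) * rnorm (adjoint T l).
  by rewrite /f mip_adjoint rnorm_mip_le.
have bound n : 2 ^+ n <= 8 * rnorm (adjoint T l).
  have y0 : 0 < rnorm (y n).
    rewrite lt_neqAle rnorm_ge0 andbT eq_sym; apply/eqP => y0.
    have := low n; have := up n; rewrite y0 mulr0 mul0r.
    have : 0 < 9^-1 ^+ n * rnorm (T (y n)) by rewrite mulr_gt0 ?exprn_gt0 ?invr_gt0.
    lra.
  rewrite -(ler_pM2r y0).
  have : 9^-1 ^+ n * (18 ^+ n * rnorm (y n)) <= 9^-1 ^+ n * rnorm (T (y n)).
    by rewrite ler_wpM2l ?exprn_ge0 ?invr_ge0// ltW.
  rewrite mulrA -exprMn.
  have -> : 9^-1 * 18 = 2 :> R by field.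
  have := low n; have := up n; nra.
have := bound (Num.truncn (8 * rnorm (adjoint T l))).+1.
rewrite leNgt => /negP; apply.
apply: (lt_trans (truncnS_gt _)).
by rewrite -natrX ltr_nat ltn_expl.
Qed.

Lemma adjointableP S T : (forall x, S x = T x) -> S = T.
Proof. by move=> eqST; apply/val_inj/funext. Qed.

Lemma adjointable_linear T (k : R[i]) x y : T (k *: x + y) = k *: T x + T y.
Proof.
apply: mip_inj => z.
by rewrite mip_adjoint !mipDl !mipZl !mip_adjoint.
Qed.

Lemma adjointableB T x y : T (x - y) = T x - T y.
Proof. by rewrite addrC -scaleN1r adjointable_linear scaleN1r addrC. Qed.

Lemma adjointableZ T (k : R[i]) x : T (k *: x) = k *: T x.
Proof.
have T0 : T 0 = 0 by have := adjointableB T 0 0; rewrite !subrr.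
by rewrite -[k *: x]addr0 adjointable_linear T0 addr0.
Qed.

Lemma id_adjointable_subproof : (id : H -> H) \in @adjointable_pred R A H.
Proof. by apply/asboolP; exists id. Qed.

Definition id_adjointable : adjointable H := Adjointable id_adjointable_subproof.

(** Since [<(M + S) x, (M + S) x>] has the cross term [2 M <S x, x>], the
    bound [c] on the numerical radius of [S], and not its norm, governs the
    growth of [|M + S|] to first order in [M]. *)
Lemma shifted_norm S (c s M : R) (M0 : 0 <= M)
    (Ssym : forall x y, mip (S x) y = mip x (S y) :> A)
    (Sc : forall x, rnorm (mip (S x) x : A) <= c * rnorm x ^+ 2)
    (Ss : forall x, rnorm (S x) <= s * rnorm x) x :
  rnorm (M%:C *: x + S x) ^+ 2 <= (M ^+ 2 + 2 * M * c + s ^+ 2) * rnorm x ^+ 2.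
Proof.
have -> : rnorm (M%:C *: x + S x) ^+ 2 =
    rnorm ((M ^+ 2)%:C *: mip x x + (2 * M)%:C *: mip (S x) x + mip (S x) (S x) : A).
  rewrite -rnorm_mip mipDr !mipDl !mipZr !mipZl conj_real_complex.
  rewrite scalerA -rmorphM /= -expr2 -(Ssym x x) !addrA.
  by rewrite mulr_natl mulr2n rmorphD scalerDl !addrA.
apply: (le_trans (rnormD _ _)); rewrite rnorm_mip [leRHS]mulrDl lerD//; last first.
  by rewrite -exprMn lerXn2r ?nnegrE ?rnorm_ge0// (le_trans _ (Ss x)) ?rnorm_ge0.
apply: (le_trans (rnormD _ _)); rewrite [leRHS]mulrDl !rnormZr rnorm_mip.
rewrite (ger0_norm (exprn_ge0 2 M0)) lerD// ger0_norm ?mulr_ge0//.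
by rewrite -mulrA ler_wpM2l ?mulr_ge0.
Qed.

(** [lam - S] is [N - (M + S)], and [M] is chosen so that [|M + S| < N]. A
    solution operator of a symmetric equation is its own adjoint, hence
    adjointable. *)
Lemma resolvent_exists S (c lam : R) (c0 : 0 <= c) (clam : c < lam)
    (Ssym : forall x y, mip (S x) y = mip x (S y) :> A)
    (Sc : forall x, rnorm (mip (S x) x : A) <= c * rnorm x ^+ 2) :
  exists Q : adjointable H, forall x, Q (lam%:C *: x - S x) = x.
Proof.
have [s s0 Ss] := adjointable_bounded S.
(* [P < N ^+ 2] amounts to [s ^+ 2 - lam ^+ 2 < 2 * M * (lam - c)], and this [M]
   makes the right-hand side [2 * s ^+ 2]. *)
pose M := s ^+ 2 / (lam - c); pose N := lam + M.
have d0 : 0 < lam - c by rewrite subr_gt0.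
have M0 : 0 <= M by rewrite divr_ge0 ?sqr_ge0// ltW.
have lam0 : 0 < lam := le_lt_trans c0 clam.
have N0 : 0 < N by exact: ltr_wpDr.
pose P := M ^+ 2 + 2 * M * c + s ^+ 2.
have P0 : 0 <= P.
  have := mulr_ge0 M0 c0; have := sqr_ge0 M; have := sqr_ge0 s; rewrite /P; lra.
have PN : P < N ^+ 2.
  have : M * (lam - c) = s ^+ 2 by rewrite divfK ?gt_eqF.
  rewrite /P /N; have := sqr_ge0 s; nra.
pose q := Num.sqrt P / N.
have q0 : 0 <= q by rewrite divr_ge0 ?sqrtr_ge0// ltW.
have q1 : q < 1.
  rewrite ltr_pdivrMr// mul1r -[N]ger0_norm ?ltW// -sqrtr_sqr.
  by rewrite ltr_sqrt// exprn_gt0.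
pose F y x := N^-1%:C *: (M%:C *: x + S x + y).
have Fq y x x' : rnorm (F y x - F y x') <= q * rnorm (x - x').
  have -> : F y x - F y x' = N^-1%:C *: (M%:C *: (x - x') + S (x - x')).
    rewrite -scalerBr; congr (_ *: _).
    rewrite opprD addrACA subrr addr0 adjointableB scalerBr.
    by rewrite opprD addrACA.
  rewrite rnormZr ger0_norm ?invr_ge0 ?(ltW N0)// /q mulrAC.
  rewrite [leLHS]mulrC ler_pM2r ?invr_gt0//.
  rewrite -(@ler_pXn2r _ 2) ?nnegrE ?mulr_ge0 ?rnorm_ge0 ?sqrtr_ge0//.
  by rewrite exprMn sqr_sqrtr// shifted_norm.
have F_fixed y x : F y x = x <-> lam%:C *: x - S x = y.
  have eqv : N%:C *: F y x = M%:C *: x + S x + y.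
    by rewrite scalerA -rmorphM /= divff ?gt_eqF// scale1r.
  split=> [Fx|xy].
    move: eqv; rewrite Fx rmorphD scalerDl addrC -addrA => /addrI ->.
    by rewrite addrAC subrr add0r.
  apply: (@scalerI _ _ N%:C); first by rewrite fmorph_eq0 gt_eqF.
  by rewrite eqv -xy addrACA subrr addr0 rmorphD scalerDl addrC.
have solve y : exists x, lam%:C *: x - S x = y.
  have [x /F_fixed ?] := contraction_fixpoint q0 q1 (Fq y); by exists x.
have [G GP] := choice solve.
have G_left x : G (lam%:C *: x - S x) = x.
  set y := lam%:C *: x - S x.
  have /F_fixed Gy := GP y; have /F_fixed xy : lam%:C *: x - S x = y by [].
  apply/eqP; rewrite -subr_eq0 -rnorm_eq0 eq_le rnorm_ge0 andbT.
  have := Fq y (G y) x; rewrite Gy xy; have := rnorm_ge0 (G y - x); nra.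
have G_adj : G \in @adjointable_pred R A H.
  apply/asboolP; exists G => x y.
  rewrite -{1}(GP y) -{2}(GP x).
  by rewrite mipBr mipBl mipZr mipZl conj_real_complex Ssym.
by exists (Adjointable G_adj).
Qed.

(** Boundedness of [T] is what makes the set of numerical values bounded above;
    the supremum of an unbounded set is 0 by convention. *)
Lemma mod_numerical_radius_ub T x :
  rnorm (mip (T x) x : A) <= mod_numerical_radius T * rnorm x ^+ 2.
Proof.
have [->|x0] := eqVneq x 0; first by rewrite mip0r !rnorm0 expr0n mulr0.
move: x0; rewrite -rnorm_gt0 => x0.
pose u := (rnorm x)^-1%:C *: x.
have u1 : rnorm u = 1.
  by rewrite rnormZr ger0_norm ?invr_ge0 ?rnorm_ge0// mulVf ?gt_eqF.
have le_u : rnorm (mip (T u) u : A) <= mod_numerical_radius T.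
  have [C C0 TC] := adjointable_bounded T.
  apply: ub_le_sup; last first.
    by exists u => //; rewrite /= -rnormE u1.
  exists (4 * C) => _ [v /= v1 <-].
  have {v1} v1 : rnorm v = 1 by rewrite /rnorm v1.
  apply: (le_trans (rnorm_mip_le _ _)); rewrite v1 mulr1 ler_pM2l//.
  by rewrite (le_trans (TC v))// v1 mulr1.
have xE : x = (rnorm x)%:C *: u.
  by rewrite /u scalerA -rmorphM /= divff ?gt_eqF// scale1r.
rewrite [in leLHS]xE adjointableZ mipZl mipZr conj_real_complex.
rewrite scalerA -rmorphM -expr2.
by rewrite rnormZr ger0_norm ?sqr_ge0// mulrC ler_wpM2r ?sqr_ge0.
Qed.

Lemma mod_numerical_radius_ge0 T : 0 <= mod_numerical_radius T.
Proof.
have [[x x0]|no] := pselect (exists x : H, x != 0).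
  have := mod_numerical_radius_ub T x; have := rnorm_ge0 (mip (T x) x : A).
  move=> /le_trans h /h; rewrite pmulr_lge0// exprn_gt0// rnorm_gt0 //.
rewrite /mod_numerical_radius (_ : [set _ | _ in _] = set0) ?sup0//.
rewrite -subset0 => _ [x /= x1 _]; apply: no; exists x.
by rewrite -normr_eq0 x1 oner_eq0.
Qed.

End HilbertModules.

(** * Symmetric operators on a Hilbert space *)

Section HilbertSpaces.
Context {R : realType} {X : hilbertType R}.
Implicit Types (x y : X) (B : bounded_op X).

Lemma dotpDl x y z : dotp (x + y) z = dotp x z + dotp y z.
Proof. by rewrite -dotp_conj dotpDr rmorphD /= !dotp_conj. Qed.

Lemma dotpZl (k : R[i]) x y : dotp (k *: x) y = Num.conj k * dotp x y.
Proof. by rewrite -dotp_conj dotpZr rmorphM /= dotp_conj. Qed.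

Lemma dotpNr x y : dotp x (- y) = - dotp x y.
Proof. by rewrite -scaleN1r dotpZr mulN1r. Qed.

Lemma dotpNl x y : dotp (- x) y = - dotp x y.
Proof. by rewrite -scaleN1r dotpZl rmorphN1 mulN1r. Qed.

Lemma dotp_rnorm x : dotp x x = (rnorm x ^+ 2)%:C.
Proof. by rewrite rmorphXn /= (rnormE x) dotp_norm sqrtCK. Qed.

Lemma bounded_op_linear B : linear B.
Proof. by have /asboolP[] := bounded_op_funP B. Qed.

Lemma bounded_opB B x y : B (x - y) = B x - B y.
Proof. by rewrite addrC -scaleN1r bounded_op_linear scaleN1r addrC. Qed.

Lemma bounded_opZ B (k : R[i]) x : B (k *: x) = k *: B x.
Proof.
have B0 : B 0 = 0 by have := bounded_opB B 0 0; rewrite !subrr.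
by rewrite -[k *: x]addr0 bounded_op_linear B0 addr0.
Qed.

Lemma bounded_op_rnorm B :
  exists2 b : R, 0 <= b & forall x, rnorm (B x) <= b * rnorm x.
Proof.
have /asboolP[_ [M BM]] := bounded_op_funP B.
exists (rnorm M); rewrite ?rnorm_ge0// => x.
rewrite -lecR rmorphM /= (rnormE M) (rnormE x) (rnormE (B x)).
apply: (le_trans (BM x)); rewrite -[X in _ <= _ * X]normr_id -normrM.
by rewrite ger0_norm// (le_trans _ (BM x)).
Qed.

(** Let [m] be the supremum of the quadratic form of [B] on the unit sphere. The
    form of [D = m - B] is nonnegative and bounded by some [K], which forces
    [|D y|^2 <= K <D y, y>]. If [m > c], then [D] is also bounded below, so
    [<D y, y>] stays away from 0 on the unit sphere, contradicting the choice of
    [m]. *)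
Lemma symmetric_le_of_resolvents B (c : R)
    (Bsym : forall x y, dotp (B x) y = dotp x (B y))
    (resolvent : forall lam : R, c < lam -> exists N : R,
       forall x, rnorm x <= N * rnorm (lam%:C *: x - B x)) x :
  rnorm x = 1 -> complex.Re (dotp (B x) x) <= c.
Proof.
move=> x1; rewrite leNgt; apply/negP => c_lt.
have [b b0 Bb] := bounded_op_rnorm B.
pose E := [set complex.Re (dotp (B y) y) | y in [set y : X | rnorm y = 1]].
have Re_dot_le y z : 2 * complex.Re (dotp y z) <= rnorm y ^+ 2 + rnorm z ^+ 2.
  have : 0 <= rnorm (y - z) ^+ 2 by rewrite sqr_ge0.
  have : (rnorm (y - z) ^+ 2)%:C =
     (rnorm y ^+ 2)%:C + (rnorm z ^+ 2)%:C - (dotp y z + Num.conj (dotp y z)).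
    rewrite -!dotp_rnorm dotp_conj dotpDr !dotpDl !dotpNr !dotpNl.
    by ring.
  move/(congr1 (@complex.Re R)) => /=.
  case: (dotp y z) => u v /=.
  lra.
have E_ub y : rnorm y = 1 -> complex.Re (dotp (B y) y) <= (b ^+ 2 + 1) / 2.
  move=> y1; have := Re_dot_le (B y) y; have := Bb y.
  rewrite y1 mulr1 expr1n => le_b; have : rnorm (B y) ^+ 2 <= b ^+ 2.
    by rewrite lerXn2r ?nnegrE ?rnorm_ge0.
  lra.
have supE : has_sup E.
  split; first by exists (complex.Re (dotp (B x) x)), x.
  by exists ((b ^+ 2 + 1) / 2) => _ [y /= y1 <-]; exact: E_ub.
pose m := sup E.
have m_ub y : rnorm y = 1 -> complex.Re (dotp (B y) y) <= m.
  by move=> y1; apply: ub_le_sup; [case: supE|exists y].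
have cm : c < m by apply: lt_le_trans c_lt (m_ub _ x1).
have [N NP] := resolvent m cm.
pose D y := m%:C *: y - B y.
pose qD y : R := complex.Re (dotp (D y) y).
have qDE y : qD y = m * rnorm y ^+ 2 - complex.Re (dotp (B y) y).
  rewrite /qD /D dotpDl dotpZl dotpNl conj_real_complex dotp_rnorm.
  by case: (dotp (B y) y) => u v /=; ring.
have qDZ (t : R) y : qD (t%:C *: y) = t ^+ 2 * qD y.
  rewrite !qDE rnormZr bounded_opZ dotpZl dotpZr conj_real_complex.
  rewrite exprMn real_normK ?num_real//.
  by case: (dotp (B y) y) => u v /=; ring.
have scale y : exists2 v, rnorm v = 1 & y = (rnorm y)%:C *: v.
  have [->|] := eqVneq y 0; first by exists x; rewrite // rnorm0 scale0r.
  rewrite -rnorm_gt0 => y0; exists ((rnorm y)^-1%:C *: y).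
    by rewrite rnormZr ger0_norm ?invr_ge0 ?rnorm_ge0// mulVf ?gt_eqF.
  by rewrite scalerA -rmorphM /= divff ?gt_eqF// scale1r.
have qD_ge0 y : 0 <= qD y.
  have [v v1 ->] := scale y; rewrite qDZ mulr_ge0 ?sqr_ge0//.
  by rewrite qDE v1 expr1n mulr1 subr_ge0 m_ub.
have qD_le : exists2 K, 0 < K & forall y, qD y <= K * rnorm y ^+ 2.
  exists (`|m| + (b ^+ 2 + 1) / 2).
    by rewrite ltr_wpDl// divr_gt0// ltr_wpDl// sqr_ge0.
  move=> y; rewrite qDE.
  have := Re_dot_le (- B y) y; rewrite dotpNl rnormN.
  have ReN (z : R[i]) : complex.Re (- z) = - complex.Re z by case: z.
  rewrite ReN; have := Bb y; have := ler_norm m.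
  have := rnorm_ge0 y; have := rnorm_ge0 (B y).
  set r := rnorm y; set r' := rnorm (B y); set t := complex.Re _ => h1 h2 h3 h4 h5.
  have h6 : r' ^+ 2 <= b ^+ 2 * r ^+ 2.
    by rewrite -exprMn lerXn2r ?nnegrE// (le_trans h1).
  have h7 : m * r ^+ 2 <= `|m| * r ^+ 2 by rewrite ler_wpM2r ?sqr_ge0.
  lra.
have [K K0 KP] := qD_le.
(* The form of [D] is nonnegative at [y - K^-1 D y]; expanding there gives the
   Cauchy-Schwarz type bound. *)
have D_le y : rnorm (D y) ^+ 2 <= K * qD y.
  pose t := K^-1.
  have expand : qD (y - t%:C *: D y) =
      qD y - 2 * t * rnorm (D y) ^+ 2 + t ^+ 2 * qD (D y).
    have DB u v : D (u - v) = D u - D v.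
      by rewrite /D bounded_opB scalerBr !opprD !opprK addrACA.
    have DZ (k : R[i]) u : D (k *: u) = k *: D u.
      by rewrite /D bounded_opZ scalerBr !scalerA mulrC.
    have Dsym u v : dotp (D u) v = dotp u (D v).
      by rewrite /D dotpDl dotpDr dotpNl dotpNr dotpZl dotpZr conj_real_complex Bsym.
    rewrite /qD DB DZ; have := Dsym (D y) y.
    move: (D y) (D (D y)) => w w' ww'.
    rewrite dotpDl !dotpDr !dotpNl !dotpNr opprK.
    rewrite !dotpZl !dotpZr conj_real_complex ww' dotp_rnorm.
    by case: (dotp w y) => u v; case: (dotp w' w) => u' v' /=; ring.
  have := qD_ge0 (y - t%:C *: D y); rewrite expand.
  have : t ^+ 2 * qD (D y) <= t ^+ 2 * (K * rnorm (D y) ^+ 2).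
    by rewrite ler_wpM2l ?sqr_ge0.
  have -> : t ^+ 2 * (K * rnorm (D y) ^+ 2) = t * rnorm (D y) ^+ 2.
    by rewrite /t; field; rewrite gt_eqF.
  move=> h1 h2; have : t * rnorm (D y) ^+ 2 <= qD y by lra.
  by rewrite -ler_pdivrMl.
have gap y : rnorm y = 1 -> 1 <= N ^+ 2 * K * (m - complex.Re (dotp (B y) y)).
  move=> y1; have := NP y; rewrite -/(D y) y1 => le1.
  apply: (@le_trans _ _ ((N * rnorm (D y)) ^+ 2)); first by rewrite exprn_ege1.
  have := D_le y; rewrite qDE y1 expr1n mulr1 => h.
  by rewrite exprMn -mulrA ler_wpM2l ?sqr_ge0.
pose g := N ^+ 2 * K.
have g0 : 0 < g.
  have := gap x x1; rewrite -/g; have := m_ub x x1; nra.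
have gV0 : 0 < g^-1 by rewrite invr_gt0.
have [_ [y /= y1 <-]] := sup_adherent gV0 supE.
rewrite -/m => lt_y; have := gap y y1; rewrite -/g leNgt => /negP; apply.
by rewrite -ltr_pdivlMl// mulr1; lra.
Qed.

End HilbertSpaces.

(** * Representations *)

Section Representations.
Context {R : realType} {A : cstarAlgType R} {H : hilbertModType A}
  {X : hilbertType R} (pi : representation H X).
Implicit Types (S T Q : adjointable H).

(** With [p = pi 1] and [D x = lam x - pi S x], the image of [Q] recovers [p x]
    from [D x], while [x - p x] equals [(D x - p (D x)) / lam] because
    [p (pi S x) = pi S x]. Both parts are bounded by [|D x|]. *)
Lemma representation_resolvent S Q (lam : R) (lam0 : 0 < lam)
    (QS : forall h, Q (lam%:C *: h - S h) = h) :
  exists N : R, forall x, rnorm x <= N * rnorm (lam%:C *: x - pi S x).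
Proof.
have [n n0 Qn] := bounded_op_rnorm (pi Q).
have [d d0 In] := bounded_op_rnorm (pi (id_adjointable H)).
exists (n + lam^-1 * (1 + d)) => x.
pose p := pi (id_adjointable H); pose D := lam%:C *: x - pi S x.
have compE U V y : pi (adjointable_comp U V) y = pi U (pi V y).
  by rewrite repr_comp.
have pS y : p (pi S y) = pi S y.
  by rewrite -compE; congr (pi _ y); apply: adjointableP.
have pQ y : pi Q (p y) = pi Q y.
  by rewrite -compE; congr (pi _ y); apply: adjointableP.
have pD : p D = lam%:C *: p x - pi S x by rewrite bounded_opB bounded_opZ pS.
have QD : pi Q D = p x.
  have -> : p x = pi (adjointable_comp Q (lam%:C *: id_adjointable H - S)) x.
    by congr (pi _ x); apply: adjointableP => h /=; rewrite QS.
  rewrite compE linearB linearZ /=.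
  by rewrite -pQ pD.
have xE : x = pi Q D + lam^-1%:C *: (D - p D).
  rewrite pD /D opprB addrA subrK -scalerBr scalerA -rmorphM /= mulVf ?gt_eqF//.
  by rewrite scale1r QD addrC subrK.
rewrite -/D [in leLHS]xE.
apply: (le_trans (rnormD _ _)); rewrite mulrDl lerD ?Qn// rnormZr.
rewrite ger0_norm ?invr_ge0 ?(ltW lam0)// -mulrA ler_pM2l ?invr_gt0//.
by apply: (le_trans (rnormB _ _)); rewrite mulrDl mul1r lerD2l In.
Qed.

Lemma representation_selfadjoint_le S (c : R) (c0 : 0 <= c)
    (Ssym : forall h k, mip (S h) k = mip h (S k) :> A)
    (Sc : forall h, rnorm (mip (S h) h : A) <= c * rnorm h ^+ 2) (x : X) :
  rnorm x = 1 -> complex.Re (dotp (pi S x) x) <= c.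
Proof.
apply: symmetric_le_of_resolvents => [y z|lam clam].
  rewrite repr_adjoint; congr (dotp _ (pi _ z)).
  apply: adjointableP => h; apply: mip_inj => k.
  by rewrite -mip_star -mip_adjoint Ssym mip_star.
have [Q QP] := resolvent_exists c0 clam Ssym Sc.
exact: representation_resolvent (le_lt_trans c0 clam) QP.
Qed.

(** Weighting [T] by the value [z] itself, instead of a phase, gives
    [|z|^2 <= |z| w(T)] and needs no choice of an argument when [z = 0]. *)
Lemma representation_numerical_range_le T (x : X) :
  rnorm x = 1 -> rnorm (dotp (pi T x) x) <= mod_numerical_radius T.
Proof.
move=> x1; pose z := dotp (pi T x) x; pose w := mod_numerical_radius T.
have w0 : 0 <= w := mod_numerical_radius_ge0 T.
pose S : adjointable H :=
  2^-1%:C *: (z *: T + Num.conj z *: adjoint T).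
have SE h : S h = 2^-1%:C *: (z *: T h + Num.conj z *: adjoint T h) by [].
have adjC h k : mip (adjoint T h) k = mip h (T k) :> A.
  by rewrite -mip_star -mip_adjoint mip_star.
have Ssym h k : mip (S h) k = mip h (S k) :> A.
  rewrite !SE mipZl mipZr conj_real_complex mipDl mipDr !mipZl !mipZr conjCK.
  by rewrite adjC mip_adjoint addrC.
have Sc h : rnorm (mip (S h) h : A) <= rnorm z * w * rnorm h ^+ 2.
  have Th := mod_numerical_radius_ub T h.
  rewrite SE mipZl conj_real_complex mipDl !mipZl conjCK adjC.
  rewrite rnormZr ger0_norm ?invr_ge0// -(mip_star (T h) h).
  rewrite ler_pdivrMl//; apply: (le_trans (rnormD _ _)).
  rewrite !rnormZ rnorm_conj rnorm_cstar mulr_natl mulr2n -mulrA.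
  by rewrite lerD// ler_wpM2l ?rnorm_ge0.
have zw0 : 0 <= rnorm z * w by rewrite mulr_ge0 ?rnorm_ge0.
have := representation_selfadjoint_le zw0 Ssym Sc x1.
have -> : dotp (pi S x) x = (rnorm z ^+ 2)%:C.
  have -> : pi S x = 2^-1%:C *: (z *: pi T x + Num.conj z *: pi (adjoint T) x).
    by rewrite /S linearZ linearD !linearZ.
  rewrite dotpZl conj_real_complex dotpDl !dotpZl conjCK -/z.
  rewrite -(dotp_conj x (pi (adjoint T) x)) -repr_adjoint -/z.
  rewrite rmorphXn /= (rnormE z) normCK fmorphV rmorph_nat.
  by field.
rewrite /= expr2 -/z -/w; have [->|z0] := eqVneq z 0; first by rewrite rnorm0.
by rewrite ler_pM2l// rnorm_gt0.
Qed.

End Representations.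

Theorem corollary3p3 (R : realType) (A : cstarAlgType R)
  (H : hilbertModType A) (X : hilbertType R) (pi : representation H X)
  (pi_faithful : faithful pi) (T : adjointable H) :
  op_numerical_radius (pi T) <= mod_numerical_radius T.
Proof.
have [[x x1]|no] := pselect (exists x : X, `|x| = 1).
  apply: ge_sup; first by exists (complex.Re `|dotp (pi T x) x|), x.
  move=> _ [y /= y1 <-]; apply: representation_numerical_range_le.
  by rewrite /rnorm y1.
rewrite /op_numerical_radius (_ : [set _ | _ in _] = set0).
  by rewrite sup0 mod_numerical_radius_ge0.
by rewrite -subset0 => _ [x /= x1 _]; apply: no; exists x.
Qed.
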